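(* Let $f:\mathbb{R}^n\to\mathbb{R}^n$, $g:\mathbb{R}^n\to\mathbb{R}^{n\times m}$, and let $h:\mathbb{R}^n\to\mathbb{R}$ be the composite soft-minimum function defined in the context, with $\mathcal S=\{x\in\mathbb{R}^n:h(x)\ge0\}$. Let $\alpha:\mathbb{R}\to\mathbb{R}$ be a nondecreasing function with $\alpha(0)=0$. Assume that $L_gh(x)\ne0$ for all $x\in\mathrm{bd}\,\mathcal S$. Then, for all $x\in\mathcal S$, there exist $\tilde u\in\mathbb{R}^m$ and $\tilde\mu\ge0$ such that $$L_fh(x)+L_gh(x)\tilde u+\alpha(h(x))+\tilde\mu h(x)\ge0.$$
   Context: Standing convention: all functions are assumed sufficiently smooth that all derivatives written exist and are continuous. For continuously differentiable $\eta$ with Jacobian $\eta'$, $L_f\eta=\eta' f$, $L_g\eta=\eta' g$, $L_f^d\eta=L_fL_f^{d-1}\eta$, $L_f^0\eta=\eta$. $\mathrm{bd}$ denotes boundary. Setting: $h_1,\dots,h_\ell:\mathbb{R}^n\to\mathbb{R}$, $\mathcal S_{\mathrm s}=\{x\in\mathbb{R}^n:h_1(x)\ge0,\dots,h_\ell(x)\ge0\}$, and for each $j\in\{1,\dots,\ell\}$ there is a positive integer $d_j$ such that for all $x\in\mathcal S_{\mathrm s}$: $L_gL_f^ih_j(x)=0$ for all $i\in\{0,\dots,d_j-2\}$, and $L_gL_f^{d_j-1}h_j(x)\ne0$. Construction of $h$: for $j\in\{1,\dots,\ell\}$, $i\in\{0,\dots,d_j-2\}$ let $\alpha_{j,i}:\mathbb{R}\to\mathbb{R}$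 be extended class-$\mathcal K$ (continuous, strictly increasing, zero at zero). Set $b_{j,0}=h_j$, $b_{j,i+1}=L_fb_{j,i}+\alpha_{j,i}(b_{j,i})$, $b_j=b_{j,d_j-1}$, and $h(x)=\mathrm{softmin}_\rho(b_1(x),\dots,b_\ell(x))$, where $\rho>0$ is fixed and $\mathrm{softmin}_\rho(z_1,\dots,z_N)=-\frac1\rho\log\sum_{i=1}^Ne^{-\rho z_i}$. *)

(* Defs.v *)
(* Points of R^n are column vectors 'cV[R]_n, where R : realType. *)
From HB Require Import structures.
From mathcomp Require Import all_boot all_order all_algebra.
From mathcomp Require Import all_classical all_reals all_analysis.

Set Implicit Arguments.
Unset Strict Implicit.
Unset Printing Implicit Defensive.

Import Order.TTheory GRing.Theory Num.Theory.
Import numFieldNormedType.Exports.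

Local Open Scope classical_set_scope.
Local Open Scope ring_scope.

Definition boundary (T : topologicalType) (A : set T) : set T :=
  closure A `\` interior A.

(* The library's 'J acts on row vectors from the right; this is the usual
   1 x n Jacobian of a scalar function, acting on column vectors from the
   left. *)
Definition jac (R : realType) (n : nat) (eta : 'cV[R]_n -> R) (x : 'cV[R]_n) :
  'rV[R]_n := \row_(j < n) 'd eta x (delta_mx j 0).

Definition C1 (R : realType) (n : nat) (eta : 'cV[R]_n -> R) : Prop :=
  (forall x, differentiable eta x) /\ continuous (jac eta).

(* The product is a 1 x 1 matrix, read as a real number. *)
Definition Lie (R : realType) (n : nat) (f : 'cV[R]_n -> 'cV[R]_n)
  (eta : 'cV[R]_n -> R) (x : 'cV[R]_n) : R := (jac eta x *m f x) 0 0.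

Definition Lie_iter (R : realType) (n : nat) (f : 'cV[R]_n -> 'cV[R]_n)
  (i : nat) (eta : 'cV[R]_n -> R) : 'cV[R]_n -> R := iter i (Lie f) eta.

Definition LieG (R : realType) (n m : nat) (g : 'cV[R]_n -> 'M[R]_(n, m))
  (eta : 'cV[R]_n -> R) (x : 'cV[R]_n) : 'rV[R]_m := jac eta x *m g x.

Definition extended_class_K (R : realType) (a : R -> R) : Prop :=
  [/\ continuous a, {homo a : s t / s < t} & a 0 = 0].

Definition softmin (R : realType) (rho : R) (N : nat) (z : 'I_N -> R) : R :=
  - rho^-1 * ln (\sum_(i < N) expR (- rho * z i)).

Definition safe_set (R : realType) (n l : nat) (hs : 'I_l -> 'cV[R]_n -> R) :
  set 'cV[R]_n := [set x | forall j, 0 <= hs j x].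

(* hocbf f a h0 i is the i-th function b_i of the sequence b_0 = h0,
   b_(i+1) = L_f b_i + a_i(b_i). *)
Fixpoint hocbf (R : realType) (n : nat) (f : 'cV[R]_n -> 'cV[R]_n)
  (a : nat -> R -> R) (h0 : 'cV[R]_n -> R) (i : nat) : 'cV[R]_n -> R :=
  if i is k.+1 then
    fun x => Lie f (hocbf f a h0 k) x + a k (hocbf f a h0 k x)
  else h0.

Definition composite_softmin (R : realType) (n l : nat) (rho : R)
  (f : 'cV[R]_n -> 'cV[R]_n) (hs : 'I_l -> 'cV[R]_n -> R) (d : 'I_l -> nat)
  (a : 'I_l -> nat -> R -> R) (x : 'cV[R]_n) : R :=
  softmin rho (fun j => hocbf f (a j) (hs j) (d j).-1 x).

Definition superlevel (R : realType) (n : nat) (h : 'cV[R]_n -> R) :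
  set 'cV[R]_n := [set x | 0 <= h x].

(* Main.v *)
(* Where h > 0, a large mu alone does the job, and where L_g h <> 0 a suitable
   u does.  In the remaining case h(x) = 0 and x is not a boundary point of S,
   so x is interior to S and thus a local minimum of h; hence dh(x) = 0 and
   every term vanishes. *)
Require Import Defs.
From HB Require Import structures.
From mathcomp Require Import all_boot all_order all_algebra.
From mathcomp Require Import all_classical all_reals all_analysis.
From mathcomp Require Import lra.

Import Order.TTheory GRing.Theory Num.Theory.
Import numFieldNormedType.Exports.

Local Open Scope classical_set_scope.
Local Open Scope ring_scope.

(** With at least one summand, the sum of exponentials is positive, so [ln] is differentiable at its
    value. *)
Lemma differentiable_softmin (R : realType) (V : normedModType R) (rho : R)
  (N : nat) (b : 'I_N -> V -> R) (x : V) :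
  (0 < N)%N -> (forall i, differentiable (b i) x) ->
  differentiable (fun y => softmin rho (b ^~ y)) x.
Proof.
move=> N_gt0 db.
pose s : V -> R := \sum_(i < N) (expR \o ((- rho) *: b i)).
have sE y : s y = \sum_(i < N) expR (- rho * b i y).
  by rewrite /s fct_sumE.
have s_gt0 : 0 < s x.
  rewrite sE; case: N N_gt0 b db {s sE} => // N _ b _.
  rewrite big_ord_recl; apply: ltr_pwDl; first exact: expR_gt0.
  by apply: sumr_ge0 => i _; exact: expR_ge0.
have -> : (fun y => softmin rho (b ^~ y)) = (- rho^-1) *: (@ln R \o s).
  by apply/funext => y; rewrite /softmin -sE.
apply: differentiableZ; apply: differentiable_comp.
  apply: differentiable_sum => i; apply: differentiable_comp.
    exact: differentiableZ.
  exact/derivable1_diffP/derivable_expR.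
by apply/derivable1_diffP; apply: ex_derive; exact: is_derive1_ln.
Qed.

(** One-sided difference quotients at a local minimum are nonnegative in every direction; linearity,
    applied to [v] and [- v], forces equality. *)
Lemma diff_local_min (R : realType) (V : normedModType R) (h : V -> R) (x v : V) :
  differentiable h x -> (\forall y \near x, h x <= h y) -> 'd h x v = 0.
Proof.
move=> dh hmin.
suff dh_ge0 w : 0 <= 'd h x w.
  by apply/eqP; rewrite eq_le dh_ge0 -oppr_ge0 -linearN dh_ge0.
have dhw : derivable h x w by exact: diff_derivable.
(* The two-sided limit exists, so it equals the limit from the right, where the factor [t^-1] is
   positive. *)
rewrite -deriveE // /derive (cvg_at_rightE _ _ dhw); apply: limr_ge.
  exact: cvgP (cvg_dnbhs_at_right dhw).
have toward_x : t *: w + x @[t --> 0^'+] --> x.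
  apply: cvg_at_right_filter; rewrite -[X in _ --> X]add0r -[X in X + x](scale0r w).
  by apply: cvgD; [apply: cvgZ; [exact: cvg_id|exact: cvg_cst]|exact: cvg_cst].
near=> t; apply: mulr_ge0; first by rewrite invr_ge0.
by rewrite subr_ge0 /=; near: t; exact: toward_x hmin.
Unshelve. all: by end_near. Qed.

Lemma row_mulmx_surj (F : fieldType) (m : nat) (r : 'rV[F]_m) (c : F) :
  r != 0 -> exists u : 'cV[F]_m, (r *m u) 0 0 = c.
Proof.
case/rV0Pn => j rj; exists ((c / r 0 j) *: delta_mx j 0).
by rewrite -scalemxAr -colE !mxE divfK.
Qed.

Theorem lemma1 (R : realType) (n m l : nat)
  (f : 'cV[R]_n -> 'cV[R]_n) (g : 'cV[R]_n -> 'M[R]_(n, m))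
  (hs : 'I_l -> 'cV[R]_n -> R) (d : 'I_l -> nat)
  (a : 'I_l -> nat -> R -> R) (rho : R) (alpha : R -> R)
  (l_gt0 : (0 < l)%N)
  (d_gt0 : forall j, (0 < d j)%N)
  (* smoothness: every function to which L_f or L_g is applied is C^1 *)
  (smooth_Lf : forall j i, (i < d j)%N -> C1 (Lie_iter f i (hs j)))
  (smooth_b : forall j i, (i < d j)%N -> C1 (hocbf f (a j) (hs j) i))
  (reldeg0 : forall j x, safe_set hs x ->
     forall i, (i.+1 < d j)%N -> LieG g (Lie_iter f i (hs j)) x = 0)
  (reldeg_neq0 : forall j x, safe_set hs x ->
     LieG g (Lie_iter f (d j).-1 (hs j)) x <> 0)
  (a_K : forall j i, (i.+1 < d j)%N -> extended_class_K (a j i))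
  (rho_gt0 : 0 < rho)
  (alpha_nondecr : {homo alpha : s t / s <= t})
  (alpha0 : alpha 0 = 0)
  (Lgh_neq0 : forall x,
     boundary (superlevel (composite_softmin rho f hs d a)) x ->
     LieG g (composite_softmin rho f hs d a) x <> 0) :
  forall x, superlevel (composite_softmin rho f hs d a) x ->
  exists (u : 'cV[R]_m) (mu : R), 0 <= mu /\
    0 <= Lie f (composite_softmin rho f hs d a) x
         + (LieG g (composite_softmin rho f hs d a) x *m u) 0 0
         + alpha (composite_softmin rho f hs d a x)
         + mu * composite_softmin rho f hs d a x.
Proof.
move=> x Sx; set h := composite_softmin _ _ _ _ _ in Lgh_neq0 Sx *.
have [Lg0|/row_mulmx_surj Lg_neq0] := eqVneq (LieG g h x) 0; last first.
  (* This [u] cancels the drift and [alpha] terms exactly, so [mu = 0] suffices. *)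
  have [u uE] := Lg_neq0 (- Lie f h x - alpha (h x)).
  by exists u, 0; split=> //; rewrite uE mul0r; lra.
exists 0; rewrite Lg0 mul0mx mxE.
have hx_ge0 : 0 <= h x := Sx.
have [hx0|hx_neq0] := eqVneq (h x) 0; last first.
  (* Then [mu * h x] is [|Lie f h x|], which dominates [- Lie f h x], while [alpha (h x)] is at
     least [alpha 0 = 0]. *)
  exists (`|Lie f h x| / h x); split; first by rewrite divr_ge0.
  have := alpha_nondecr _ _ hx_ge0; rewrite alpha0 divfK //.
  have := ler_norm (- Lie f h x); rewrite normrN; lra.
exists 0; split=> //; rewrite hx0 alpha0 mul0r !addr0.
(* Otherwise [x], being in the closure, would be a boundary point, contradicting [Lg0]. *)
have intx : nbhs x (superlevel h).
  apply: contrapT => nintx; apply: (Lgh_neq0 x) Lg0.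
  by split; [exact: subset_closure|].
have dh : differentiable h x.
  apply: differentiable_softmin => // j.
  (* Positivity of [d j] gives [(d j).-1 < d j], so [smooth_b] reaches the last function of each
     sequence. *)
  by have [] := smooth_b j (d j).-1 _; rewrite ?prednK.
rewrite /Lie (_ : jac h x = 0) ?mul0mx ?mxE //.
apply/rowP => j; rewrite !mxE; apply: diff_local_min => //.
(* Near [x] the values of [h] are at least [0 = h x]. *)
by rewrite hx0; exact: intx.
Qed.
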